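(* The annotated synchrony lattices of the connected three-cell networks listed in the context are as follows, where the bottom is always the full-synchrony subspace $\Delta_0=\{x_1=x_2=x_3\}$ annotated with the valency eigenvalue $\upsilon$, the top is $\mathbb{R}^3$, and the only other elements are the two-dimensional (2D) synchrony subspaces indicated (distinct symbols denote distinct network eigenvalues): (1) $E_6\&E_4$: one 2D synchrony subspace annotated $\upsilon,\mu$; top annotated $\upsilon,\upsilon,\mu$. (2) $C$ and $C_1\&C_2$: three 2D synchrony subspaces, each annotated $\upsilon,\mu$; top annotated $\upsilon,\mu,\mu$ ($\mu$ semisimple). (3) $D$, $C_1\&D_1$, $C_1\&D_4$, $C_1\&D_6$, $D_1\&D_4$: one 2D synchrony subspace annotated $\upsilon,\mu$; top annotated $\upsilon,\mu^*$. (4) $A$, all networks in Lists I and II, and $\mathcal{M}_6$: no 2D synchrony subspace; top annotated $\upsilon,\mu_1,\mu_2$. (5) All networks in List III: one 2D synchrony subspace annotated $\upsilon,\mu_1$; top annotated $\upsilon,\mu_1,\mu_2$. (6) $F$ and all networks in List V: two 2D synchrony subspaces, annotated $\upsilon,\mu_1$ and $\upsilon,\mu_2$ respectively; top annotated $\upsilon,\mu_1,\mu_2$.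
   Context: **Networks.** A three-cell network with $k$ asymmetric inputs has cells $1,2,3$ and edges of $k$ types, each cell receiving exactly one edge of each type. An edge type is described by $[a\,b\,c]$, meaning that the edges of that type ending at cells $1,2,3$ start at cells $a,b,c$ respectively; its adjacency matrix $A_l$ has $(A_l)_{ij}=1$ if the type-$l$ edge ending at $i$ starts at $j$, and $0$ otherwise. Edge types: $A_1=[3\,1\,2]$, $A_2=[2\,3\,1]$; $B_1=[1\,3\,2]$, $B_2=[3\,2\,1]$, $B_3=[2\,1\,3]$; $C_1=[1\,1\,1]$, $C_2=[2\,2\,2]$; $D_1=[1\,1\,2]$, $D_2=[1\,3\,1]$, $D_4=[2\,2\,1]$, $D_5=[3\,1\,3]$, $D_6=[2\,3\,3]$; $E_1=[1\,2\,1]$, $E_3=[1\,2\,2]$, $E_4=[1\,3\,3]$, $E_6=[1\,1\,3]$; $F_1=[2\,1\,1]$, $F_2=[2\,1\,2]$, $F_3=[2\,3\,2]$, $F_4=[3\,3\,2]$, $F_5=[3\,3\,1]$, $F_6=[3\,1\,1]$. (In this list the letters name edge types.) $X\&Y$ denotes the network with two asymmetric inputs whose first and second edge types are $X$ and $Y$. One-input networks: $A=[3\,1\,2]$, $C=[1\,1\,1]$, $D=[1\,1\,2]$, $F=[2\,1\,1]$. List I: $E_6\&B_1$, $B_1\&F_2$, $C_1\&A_2$, $A_2\&A_1$, $B_1\&B_3$. List II: $D_1\&F_3$, $D_1\&D_6$, $D_1\&F_6$, $D_1\&A_1$, $D_1\&D_2$, $D_1\&D_5$, $D_1\&B_1$,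 $D_1\&B_2$, $D_1\&E_4$, $E_6\&A_2$, $B_1\&A_2$, $F_1\&A_2$, $D_1\&A_2$, $F_1\&A_1$. List III: $D_1\&E_1$, $D_1\&F_1$, $D_1\&F_2$, $D_1\&B_3$, $C_1\&B_1$, $D_1\&F_4$, $C_1\&B_3$, $E_6\&F_3$, $D_1\&E_6$, $E_6\&F_6$, $E_6\&F_4$, $B_1\&F_1$, $F_1\&F_2$, $F_1\&F_3$, $F_1\&F_6$, $D_1\&F_5$. List IV: $E_6\&E_4$, $C_1\&D_1$, $C_1\&D_4$, $C_1\&D_6$, $D_1\&D_4$. List V: $C_1\&E_6$, $C_1\&E_3$, $C_1\&F_1$, $C_1\&F_2$, $C_1\&F_3$, $E_6\&F_5$, $F_1\&F_4$. List VI: $C_1\&C_2$. Six-input network $\mathcal{M}_6$: edge types $[1\,1\,1]$, $[2\,2\,2]$, $[3\,3\,3]$, $[1\,1\,2]$, $[3\,2\,2]$, $[3\,1\,3]$. **Network eigenvalues.** A smooth $f:\mathbb{R}\times\mathbb{R}^k\times\mathbb{R}\to\mathbb{R}$ (last variable a parameter $\lambda$) defines $f^{\mathcal{N}}_i(x,\lambda)=f(x_i,x_{i_1},\dots,x_{i_k},\lambda)$, $i_j$ the source of the type-$j$ edge ending at $i$. With $f_j$ the derivative of $f$ at the origin with respect to its $(j+1)$-th variable, the Jacobian at the origin is $J_f^{\mathcal{N}}=f_0\mathrm{Id}_3+\sum_{j=1}^kf_jA_j$ ($A_j$ here the adjacency matrix of the $j$-th edge type). Network eigenvalues are the continuous functions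 of $(f_0,\dots,f_k)$ giving the distinct eigenvalues of $J_f^{\mathcal{N}}$ for generic $f$ (i.e. $f$ satisfying finitely many non-trivial inequalities $\neq$ on derivatives at the origin). The valency eigenvalue is $\upsilon=\sum_{j=0}^kf_j$. **Annotated synchrony lattice.** A synchrony subspace is a polydiagonal (subspace of $\mathbb{R}^3$ defined by equalities $x_i=x_j$) invariant under all adjacency matrices of the network; the synchrony subspaces form a lattice under inclusion. The restriction of $f^{\mathcal{N}}$ to a synchrony subspace is the coupled cell system defined by $f$ on a quotient network; each synchrony subspace is annotated with the network eigenvalues of its quotient, repeated according to multiplicity, except that a defective eigenvalue with algebraic multiplicity $2$ and geometric multiplicity $1$ is written once with a star, $\mu^*$. *)

(* Defs.v *)
From HB Require Import structures.
From mathcomp Require Import all_boot all_order all_algebra.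
From mathcomp Require Import complex.
From mathcomp Require Import all_classical all_reals all_analysis.
(* The notations of mpoly clash with those of MathComp-Analysis. *)
From mathcomp Require Import -(notations) mpoly.

Set Implicit Arguments.
Unset Strict Implicit.
Unset Printing Implicit Defensive.

Import Order.TTheory GRing.Theory Num.Theory.
Import numFieldNormedType.Exports.
Local Open Scope ring_scope.

(* [tuple a; b; c] gives the sources of the edges ending at cells 1, 2, 3. *)
Definition edge_type (n : nat) := n.-tuple 'I_n.

Definition network (n k : nat) := k.-tuple (edge_type n).

Definition src n k (N : network n k) (l : 'I_k) (i : 'I_n) : 'I_n :=
  tnth (tnth N l) i.

Section CoupledCells.

Variable R : realType.

Definition adjacency n k (N : network n k) (l : 'I_k) : 'M[R]_n :=
  \matrix_(i, j) (src N l i == j)%:R.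

(* The arguments of f are those of R x R^k x R: the state of the cell itself,
   its k inputs, and the parameter lambda. *)
Definition response k := 'rV[R]_(1 + k + 1) -> R.

Definition partial k (j : 'I_(1 + k + 1)) (f : response k) : response k :=
  fun x => 'D_(delta_mx 0 j) f x.

Fixpoint times_differentiable k (m : nat) (f : response k) : Prop :=
  if m is m'.+1 then
    (forall x, differentiable f x) /\
    (forall j, times_differentiable m' (partial j f))
  else True.

Definition smooth k (f : response k) := forall m, times_differentiable m f.

Definition coupled_cell_system n k (N : network n k) (f : response k)
    (lambda : R) (x : 'rV[R]_n) : 'rV[R]_n :=
  \row_i f (row_mx (row_mx (x 0 i)%:M (\row_l x 0 (src N l i))) lambda%:M).

(* MathComp's jacobian acts on row vectors on the right, so this is the
   transpose of the matrix f_0 Id + \sum_l f_l A_l.  Its (left) eigenspaces in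
   the sense of MathComp are the usual eigenspaces of that matrix. *)
Definition origin_jacobian n k (N : network n k) (f : response k) : 'M[R[i]]_n :=
  map_mx (real_complex R) ('J (coupled_cell_system N f 0) 0).

(* (f_0, ..., f_k) *)
Definition first_derivatives k (f : response k) : 'rV[R]_(1 + k) :=
  \row_j partial (lshift 1 j) f 0.

(* P holds for all smooth f satisfying certain finitely many polynomial
   inequalities p(f_0, ..., f_k) <> 0 with p nonzero. *)
Definition generic k (P : response k -> Prop) : Prop :=
  exists ps : seq (mpoly (1 + k) R),
    all (fun p => p != 0) ps /\
    forall f, smooth f ->
      all (fun p => meval (first_derivatives f 0) p != 0) ps -> P f.

Definition eigfun k := 'rV[R]_(1 + k) -> R[i].

Definition valency k : eigfun k := fun v => (\sum_j v 0 j)%:C%C.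

Definition network_eigenvalues n k (N : network n k) (mus : seq (eigfun k)) :=
  (forall mu, mu \in mus -> continuous (mu : _ -> R[i]^o)) /\
  generic (fun f : response k =>
    let vals := [seq mu (first_derivatives f) | mu <- mus] in
    uniq vals /\ forall z, eigenvalue (origin_jacobian N f) z = (z \in vals)).

Definition alg_mult n (M : 'M[R[i]]_n) (z : R[i]) : nat := mup z (char_poly M).

Definition geo_mult n (M : 'M[R[i]]_n) (z : R[i]) : nat :=
  \rank (eigenspace M z).

(* A list up to order; the boolean says whether the eigenvalue is starred. *)
Definition annotation k := seq (eigfun k * bool).

Definition plain k (mu : eigfun k) := (mu, false).
Definition star k (mu : eigfun k) := (mu, true).

Definition annotates n k (N : network n k) (a : annotation k) : Prop :=
  exists mus : seq (eigfun k),
    [/\ network_eigenvalues N mus,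
        forall e, e \in a -> e.1 \in mus &
        forall mu, mu \in mus -> generic (fun f : response k =>
          let am := alg_mult (origin_jacobian N f) (mu (first_derivatives f)) in
          let gm := geo_mult (origin_jacobian N f) (mu (first_derivatives f)) in
          if (am == 2)%N && (gm == 1)%N
          then count_mem (star mu) a = 1%N /\ count_mem (plain mu) a = 0%N
          else count_mem (star mu) a = 0%N /\ count_mem (plain mu) a = am)].

Definition polydiagonal n (E : rel 'I_n) (V : {vspace 'rV[R]_n}) : Prop :=
  forall x, x \in V <-> (forall i j, E i j -> x 0 i = x 0 j).

Definition synchrony n k (N : network n k) (V : {vspace 'rV[R]_n}) : Prop :=
  (exists E : rel 'I_n, polydiagonal E V) /\
  (forall l x, x \in V -> x *m (adjacency N l)^T \in V).

(* The cells of the quotient Q are the classes of cells equal on V, numbered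
   by c. *)
Definition is_quotient n m k (N : network n k) (V : {vspace 'rV[R]_n})
    (Q : network m k) : Prop :=
  exists c : 'I_n -> 'I_m,
    [/\ forall y, exists x, c x = y,
        polydiagonal [rel i j | c i == c j] V &
        forall l i, src Q l (c i) = c (src N l i)].

Definition annotated n k (N : network n k) (V : {vspace 'rV[R]_n})
    (a : annotation k) : Prop :=
  exists m (Q : network m k), is_quotient N V Q /\ annotates Q a.

(* The lattice of synchrony subspaces of N consists of Delta_0 annotated with
   the valency eigenvalue, of 2D subspaces annotated by mids, respectively, and
   of R^3 annotated by top. *)
Definition annotated_lattice k (N : network 3 k) (mids : seq (annotation k))
    (top : annotation k) : Prop :=
  exists (Delta0 : {vspace 'rV[R]_3}) (Vs : seq {vspace 'rV[R]_3}),
    [/\ polydiagonal (fun _ _ => true) Delta0,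
        uniq Vs /\ (forall V, V \in Vs -> \dim V = 2%N),
        (forall V, synchrony N V <-> [\/ V = Delta0, V \in Vs | V = fullv]),
        size Vs = size mids &
        [/\ annotated N Delta0 [:: plain (@valency k)],
            forall j, (j < size mids)%N ->
              annotated N (nth fullv Vs j) (nth [::] mids j) &
            annotated N fullv top]].

Section LatticeShapes.

Variables (k : nat) (N : network 3 k).

Let upsilon : eigfun k := @valency k.

Definition lattice1 : Prop := exists mu : eigfun k,
  uniq [:: upsilon; mu] /\
  annotated_lattice N
    [:: [:: plain upsilon; plain mu]]
    [:: plain upsilon; plain upsilon; plain mu].

Definition lattice2 : Prop := exists mu : eigfun k,
  uniq [:: upsilon; mu] /\
  annotated_lattice N
    [:: [:: plain upsilon; plain mu];
        [:: plain upsilon; plain mu];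
        [:: plain upsilon; plain mu]]
    [:: plain upsilon; plain mu; plain mu].

Definition lattice3 : Prop := exists mu : eigfun k,
  uniq [:: upsilon; mu] /\
  annotated_lattice N
    [:: [:: plain upsilon; plain mu]]
    [:: plain upsilon; star mu].

Definition lattice4 : Prop := exists mu1 mu2 : eigfun k,
  uniq [:: upsilon; mu1; mu2] /\
  annotated_lattice N
    [::]
    [:: plain upsilon; plain mu1; plain mu2].

Definition lattice5 : Prop := exists mu1 mu2 : eigfun k,
  uniq [:: upsilon; mu1; mu2] /\
  annotated_lattice N
    [:: [:: plain upsilon; plain mu1]]
    [:: plain upsilon; plain mu1; plain mu2].

Definition lattice6 : Prop := exists mu1 mu2 : eigfun k,
  uniq [:: upsilon; mu1; mu2] /\
  annotated_lattice N
    [:: [:: plain upsilon; plain mu1]; [:: plain upsilon; plain mu2]]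
    [:: plain upsilon; plain mu1; plain mu2].

End LatticeShapes.

End CoupledCells.

Definition c1 : 'I_3 := @Ordinal 3 0 isT.
Definition c2 : 'I_3 := @Ordinal 3 1 isT.
Definition c3 : 'I_3 := @Ordinal 3 2 isT.

Definition edges (a b c : 'I_3) : edge_type 3 := [tuple a; b; c].

Definition A_1 := edges c3 c1 c2.
Definition A_2 := edges c2 c3 c1.
Definition B_1 := edges c1 c3 c2.
Definition B_2 := edges c3 c2 c1.
Definition B_3 := edges c2 c1 c3.
Definition C_1 := edges c1 c1 c1.
Definition C_2 := edges c2 c2 c2.
Definition D_1 := edges c1 c1 c2.
Definition D_2 := edges c1 c3 c1.
Definition D_4 := edges c2 c2 c1.
Definition D_5 := edges c3 c1 c3.
Definition D_6 := edges c2 c3 c3.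
Definition E_1 := edges c1 c2 c1.
Definition E_3 := edges c1 c2 c2.
Definition E_4 := edges c1 c3 c3.
Definition E_6 := edges c1 c1 c3.
Definition F_1 := edges c2 c1 c1.
Definition F_2 := edges c2 c1 c2.
Definition F_3 := edges c2 c3 c2.
Definition F_4 := edges c3 c3 c2.
Definition F_5 := edges c3 c3 c1.
Definition F_6 := edges c3 c1 c1.

Definition one_input (X : edge_type 3) : network 3 1 := [tuple X].
Definition two_inputs (X Y : edge_type 3) : network 3 2 := [tuple X; Y].

Notation "X \& Y" := (two_inputs X Y) (at level 40, no associativity).

Definition net_A := one_input (edges c3 c1 c2).
Definition net_C := one_input (edges c1 c1 c1).
Definition net_D := one_input (edges c1 c1 c2).
Definition net_F := one_input (edges c2 c1 c1).

Definition list_I : seq (network 3 2) :=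
  [:: E_6 \& B_1; B_1 \& F_2; C_1 \& A_2; A_2 \& A_1; B_1 \& B_3].

Definition list_II : seq (network 3 2) :=
  [:: D_1 \& F_3; D_1 \& D_6; D_1 \& F_6; D_1 \& A_1; D_1 \& D_2;
      D_1 \& D_5; D_1 \& B_1; D_1 \& B_2; D_1 \& E_4; E_6 \& A_2;
      B_1 \& A_2; F_1 \& A_2; D_1 \& A_2; F_1 \& A_1].

Definition list_III : seq (network 3 2) :=
  [:: D_1 \& E_1; D_1 \& F_1; D_1 \& F_2; D_1 \& B_3; C_1 \& B_1;
      D_1 \& F_4; C_1 \& B_3; E_6 \& F_3; D_1 \& E_6; E_6 \& F_6;
      E_6 \& F_4; B_1 \& F_1; F_1 \& F_2; F_1 \& F_3; F_1 \& F_6;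
      D_1 \& F_5].

Definition list_V : seq (network 3 2) :=
  [:: C_1 \& E_6; C_1 \& E_3; C_1 \& F_1; C_1 \& F_2; C_1 \& F_3;
      E_6 \& F_5; F_1 \& F_4].

Definition net_M6 : network 3 6 :=
  [tuple edges c1 c1 c1; edges c2 c2 c2; edges c3 c3 c3;
         edges c1 c1 c2; edges c3 c2 c2; edges c3 c1 c3].

(* Main.v *)
(* A smooth f enters the Jacobian at the origin only through its first derivatives
   v = (f_0, ..., f_k), and the entries of the Jacobian are linear forms in v. All rows
   sum to the valency, so subtracting the first row leaves a 2 x 2 block whose trace
   and determinant give the two remaining eigenvalues. A two-dimensional synchrony
   subspace isolating the cell c (i and j being synchronous) contributes the root
   m_cc - m_ic of the quadratic polynomial of this block, so these roots are linear in
   v as soon as there is such a subspace; otherwise they are expressed continuously by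
   the complex square root of the discriminant. Each generic condition is the
   nonvanishing of a polynomial in v with integer coefficients, and evaluation at a
   single integer point shows that this polynomial is not zero. *)
Require Import Defs.
From mathcomp Require Import all_boot all_order all_algebra.
From mathcomp Require Import complex.
From mathcomp Require Import all_classical all_reals all_analysis.
From mathcomp Require Import -(notations) mpoly.
From mathcomp Require Import ring lra.

Set Implicit Arguments.
Unset Strict Implicit.
Unset Printing Implicit Defensive.

Import Order.TTheory GRing.Theory Num.Theory.
Import numFieldNormedType.Exports.
Local Open Scope ring_scope.

(** * The Jacobian at the origin *)

(** The coefficient ring is arbitrary so that the same linear form can be evaluated at reals, at
    integers and at polynomial indeterminates. *)
Definition entry (A : comNzRingType) n k (N : network n k)
    (v : 'I_(1 + k) -> A) (i j : 'I_n) : A :=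
  v (lshift k ord0) *+ (i == j) + \sum_l v (rshift 1 l) *+ (src N l i == j).

Lemma rmorph_entry (A B : comNzRingType) (phi : {rmorphism A -> B}) n k
    (N : network n k) (v : 'I_(1 + k) -> A) i j :
  phi (entry N v i j) = entry N (fun l => phi (v l)) i j.
Proof.
rewrite /entry rmorphD rmorphMn rmorph_sum; congr (_ + _).
by apply: eq_bigr => l _; rewrite rmorphMn.
Qed.

Lemma sum_mulrb (A : comNzRingType) n (a : A) (i : 'I_n) :
  \sum_j a *+ (i == j) = a.
Proof.
rewrite (bigD1 i) //= eqxx mulr1n big1 ?addr0 // => j.
by rewrite eq_sym => /negbTE ->.
Qed.

(** Every cell receives exactly one edge of each type, so each [v l] occurs once per row. *)
Lemma sum_entry (A : comNzRingType) n k (N : network n k)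
    (v : 'I_(1 + k) -> A) i : \sum_j entry N v i j = \sum_l v l.
Proof.
rewrite big_split /= exchange_big /= big_split_ord big_ord1 sum_mulrb.
by congr (_ + _); apply: eq_bigr => l _; rewrite sum_mulrb.
Qed.

Section Jacobian.

Variables (R : realType) (n k : nat) (N : network n k).
Implicit Types (f : response R k) (x : 'rV[R]_n).

Let cell_input i x : 'rV[R]_(1 + k + 1) :=
  row_mx (row_mx (x 0 i)%:M (\row_l x 0 (src N l i))) 0%:M.

Let cell_inputE i x : cell_input i x =
  x 0 i *: delta_mx 0 (lshift 1 (lshift k ord0)) +
  \sum_l x 0 (src N l i) *: delta_mx 0 (lshift 1 (rshift 1 l)).
Proof.
apply/rowP => j; rewrite !mxE summxE; case: splitP => j' jj'; rewrite !mxE.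
  have -> : j = lshift 1 j' by apply/val_inj.
  case: splitP => l jl; rewrite !mxE.
    have -> : j' = lshift k l by apply/val_inj.
    rewrite ord1 eqxx (inj_eq (@lshift_inj _ _)) eqxx mulr1 big1 ?addr0 // => m _.
    by rewrite !mxE (inj_eq (@lshift_inj _ _)) eq_lrshift andbF mulr0.
  have -> : j' = rshift 1 l by apply/val_inj.
  rewrite (inj_eq (@lshift_inj _ _)) eq_rlshift andbF mulr0 add0r.
  rewrite (bigD1 l) //= !mxE !eqxx mulr1 big1 ?addr0 // => m ml.
  by rewrite !mxE (inj_eq (@lshift_inj _ _)) eq_rshift (eq_sym l) (negbTE ml) mulr0.
have -> : j = rshift (1 + k) j' by apply/val_inj.
rewrite mul0rn eq_rlshift andbF mulr0 add0r big1 // => l _.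
by rewrite !mxE eq_rlshift andbF mulr0.
Qed.

Let cell_inputZ i a x : cell_input i (a *: x) = a *: cell_input i x.
Proof.
rewrite !cell_inputE scalerDr scaler_sumr mxE scalerA; congr (_ + _).
by apply: eq_bigr => l _; rewrite mxE scalerA.
Qed.

Let differentiable_cell_input i x : differentiable (cell_input i) x.
Proof.
rewrite (_ : cell_input i = (fun x => x 0 i *: delta_mx 0 (lshift 1 (lshift k ord0)))
  + \sum_l (fun x => x 0 (src N l i) *: delta_mx 0 (lshift 1 (rshift 1 l)))).
  apply: differentiableD; first exact/differentiableZl/differentiable_coord.
  by apply: differentiable_sum => l; exact/differentiableZl/differentiable_coord.
by apply/funext => y; rewrite cell_inputE fctE fct_sumE.
Qed.

(** Component i of the system is f composed with the linear map [cell_input i], so its derivative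
    along a basis vector is the derivative of f along the image of that vector, which expands by
    linearity of the differential. *)
Lemma origin_jacobianE f : smooth f ->
  origin_jacobian N f =
  \matrix_(j, i) (entry N (first_derivatives f 0) i j)%:C%C.
Proof.
move=> /(_ 1%N)[df _].
pose F i x := f (cell_input i x).
have dF i x : differentiable (F i) x.
  by apply: (@differentiable_comp _ _ _ _ (cell_input i) f).
have dG : differentiable (coupled_cell_system N f 0) 0.
  rewrite (_ : coupled_cell_system N f 0 =
      \sum_i (fun x => F i x *: (delta_mx 0 i : 'rV[R]_n))).
    by apply: differentiable_sum => i; apply: differentiableZl.
  apply/funext => x; apply/rowP => i; rewrite fct_sumE summxE !mxE.
  rewrite (bigD1 i) //= !mxE !eqxx mulr1 big1 ?addr0 // => j ji.
  by rewrite !mxE eq_sym (negbTE ji) andbF mulr0.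
apply/matrixP => j i; rewrite /origin_jacobian !mxE; congr (_%:C)%C.
rewrite -deriveE // derive_mx; last exact: diff_derivable.
rewrite mxE (_ : (fun t => _) = F i); last by apply/funext => x; rewrite mxE.
(* By linearity of [cell_input i] the two difference quotients agree for every h, before any limit
   is taken. *)
have -> : 'D_(delta_mx 0 j) (F i) 0 = 'D_(cell_input i (delta_mx 0 j)) f 0.
  have cell_input0 : cell_input i 0 = 0.
    by rewrite -(scale0r 0) cell_inputZ scale0r.
  have quotE h : h^-1 *: ((F i \o shift 0) (h *: delta_mx 0 j) - F i 0) =
      h^-1 *: ((f \o shift 0) (h *: cell_input i (delta_mx 0 j)) - f 0).
    by rewrite /F /= !addr0 cell_inputZ cell_input0.
  by rewrite /derive (funext quotE).
rewrite deriveE // cell_inputE linearD linear_sum linearZ /=.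
rewrite /entry !mxE /partial -deriveE // scaler_nat; congr (_ + _).
apply: eq_bigr => l _.
by rewrite linearZ -deriveE //= !mxE scaler_nat.
Qed.

End Jacobian.

(** * Genericity *)

Section Genericity.

Variables (R : realType) (k : nat).

(** [generic] with the vector of first derivatives as the variable, which leaves a question about
    polynomials only. *)
Definition generically (P : 'rV[R]_(1 + k) -> Prop) : Prop :=
  exists ps : seq (mpoly (1 + k) R), all (fun p => p != 0) ps /\
    forall v : 'rV[R]_(1 + k), all (fun p => meval (v 0) p != 0) ps -> P v.

Lemma generically_all (P : 'rV[R]_(1 + k) -> Prop) :
  (forall v, P v) -> generically P.
Proof. by move=> allP; exists [::]. Qed.

Lemma generically_sub (P Q : 'rV[R]_(1 + k) -> Prop) :
  (forall v, P v -> Q v) -> generically P -> generically Q.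
Proof. by move=> PQ [ps [ps0 psP]]; exists ps; split=> // v /psP/PQ. Qed.

Lemma generically_and (P Q : 'rV[R]_(1 + k) -> Prop) :
  generically P -> generically Q -> generically (fun v => P v /\ Q v).
Proof.
move=> [ps [ps0 psP]] [qs [qs0 qsQ]]; exists (ps ++ qs); rewrite all_cat ps0.
by split=> // v; rewrite all_cat => /andP[/psP Pv /qsQ Qv].
Qed.

Lemma generically_generic (P : 'rV[R]_(1 + k) -> Prop) (Q : response R k -> Prop) :
  (forall f, smooth f -> P (first_derivatives f) -> Q f) ->
  generically P -> generic Q.
Proof.
by move=> PQ [ps [ps0 psP]]; exists ps; split=> // f sf /psP; apply: PQ.
Qed.

(** Compatibility with all ring morphisms characterises the polynomials with integer coefficients:
    such a p is determined by its value at the indeterminates. *)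
Definition natural (p : forall A : comNzRingType, ('I_(1 + k) -> A) -> A) :=
  forall (A B : comNzRingType) (phi : {rmorphism A -> B}) v,
    phi (p A v) = p B (fun l => phi (v l)).

(* An arbitrary point of Z^(1+k): the values 1, 3, 5, ... make all the polynomials
   that must not vanish identically nonzero for the networks of the theorem. *)
Definition probe (l : 'I_(1 + k)) : int := nth 0 [:: 0; 1; 3; 5; 11; 17; 23] l.

(** The polynomial required not to vanish is p taken at the indeterminates. If it were zero,
    evaluating it at [probe] would give 0 in R, hence in the integers. *)
Lemma generically_neq0 p : natural p -> p int probe != 0 ->
  generically (fun v => p R (v 0) != 0).
Proof.
move=> natp p0; exists [:: p _ (fun l => mpolyX R (mnm1 l))]; split=> /=.
  rewrite andbT; apply: contraNneq p0 => /(congr1 (meval (fun l => (probe l)%:~R))).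
  rewrite meval0 natp (_ : (fun l => meval _ _) = fun l => (probe l)%:~R); last first.
    by apply/funext => l; rewrite mevalXU.
  by rewrite -(natp _ _ intr) => /eqP; rewrite intr_eq0.
move=> v; rewrite andbT natp (_ : (fun l => meval _ _) = v 0) //.
by apply/funext => l; rewrite mevalXU.
Qed.

End Genericity.

(** * Characteristic polynomials of matrices with constant row sums *)

Lemma det_mx33 (A : comNzRingType) (M : 'M[A]_3) :
  \det M = M c1 c1 * (M c2 c2 * M c3 c3 - M c2 c3 * M c3 c2)
         - M c1 c2 * (M c2 c1 * M c3 c3 - M c2 c3 * M c3 c1)
         + M c1 c3 * (M c2 c1 * M c3 c2 - M c2 c2 * M c3 c1).
Proof.
(* Indexing by natural numbers identifies the various forms in which cofactor expansion produces the
   same ordinal. *)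
pose a i j := M (inord i) (inord j).
have Ma i j : M i j = a i j by rewrite /a !inord_val.
rewrite (expand_det_row _ ord0) !big_ord_recl big_ord0 /cofactor.
rewrite !(expand_det_row _ ord0) !big_ord_recl !big_ord0 /cofactor !det_mx11 !mxE.
rewrite !Ma /= /bump /= !addn0 !add1n !addn1 /=.
move: a {Ma} => a.
ring.
Qed.

Section CharPoly.

Variable A : comNzRingType.

(* In the basis (1,1,1), e_2, e_3 a matrix m with constant row sum is block
   triangular; transverse m is its lower right 2 x 2 block. *)
Definition transverse (m : 'I_3 -> 'I_3 -> A) (i j : 'I_3) : A := m i j - m c1 j.

Definition ttr (m : 'I_3 -> 'I_3 -> A) : A :=
  transverse m c2 c2 + transverse m c3 c3.

Definition tdet (m : 'I_3 -> 'I_3 -> A) : A :=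
  transverse m c2 c2 * transverse m c3 c3 - transverse m c2 c3 * transverse m c3 c2.

Lemma sum3 (F : 'I_3 -> A) : \sum_i F i = F c1 + F c2 + F c3.
Proof.
rewrite !big_ord_recl big_ord0 addr0 addrA.
by congr (F _ + F _ + F _); apply/val_inj.
Qed.

(** Eliminating the first column through the row sums leaves a polynomial identity in which [mu1]
    and [mu2] enter only through their sum and product. *)
Lemma char_poly3 (m : 'I_3 -> 'I_3 -> A) (s mu1 mu2 : A) :
  (forall i, \sum_j m i j = s) -> mu1 + mu2 = ttr m -> mu1 * mu2 = tdet m ->
  char_poly (\matrix_(j, i) m i j) =
  \prod_(z <- [:: s; mu1; mu2]) ('X - z%:P).
Proof.
move=> ms m12 m12'; have mc1 i : m i c1 = s - m i c2 - m i c3.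
  by rewrite -(ms i) sum3; ring.
rewrite !big_cons big_nil mulr1.
have -> : ('X - mu1%:P) * ('X - mu2%:P) =
    'X * 'X - (ttr m)%:P * 'X + (tdet m)%:P.
  by rewrite -m12 -m12' polyCD polyCM; ring.
rewrite /char_poly det_mx33 !mxE /= !mulr0n !mulr1n !mc1 /ttr /tdet /transverse.
rewrite !(polyCD, polyCN, polyCM); ring.
Qed.

Lemma char_poly2 (m : 'I_2 -> 'I_2 -> A) (s : A) :
  (forall i, \sum_j m i j = s) ->
  char_poly (\matrix_(j, i) m i j) =
  \prod_(z <- [:: s; m ord_max ord_max - m ord0 ord_max]) ('X - z%:P).
Proof.
pose a i j := m (inord i) (inord j).
have ma i j : m i j = a i j by rewrite /a !inord_val.
move=> ms; have a0 i : m i ord0 = s - m i ord_max.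
  by rewrite -(ms i) !big_ord_recl big_ord0 !ma /=; ring.
have [a00 a10] := (a0 ord0, a0 ord_max).
rewrite !big_cons big_nil mulr1.
rewrite /char_poly (expand_det_row _ ord0) !big_ord_recl big_ord0 /cofactor.
rewrite !det_mx11 !mxE -!val_eqE /= !mulr0n !mulr1n.
rewrite !ma /= in a00 a10 *.
rewrite a00 a10 !(polyCD, polyCN); move: (a) => b; ring.
Qed.

Lemma char_poly1 (m : 'I_1 -> 'I_1 -> A) (s : A) :
  (forall i, \sum_j m i j = s) ->
  char_poly (\matrix_(j, i) m i j) = \prod_(z <- [:: s]) ('X - z%:P).
Proof.
move=> /(_ ord0); rewrite big_ord1 => ms.
by rewrite /char_poly det_mx11 !mxE eqxx mulr1n ms big_seq1.
Qed.

End CharPoly.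

(** * Annotations from the characteristic polynomial *)

Section Annotations.

Variables (R : realType) (n k : nat) (N : network n k).
Implicit Types (mu : eigfun R k) (mus roots : seq (eigfun R k)) (v : 'rV[R]_(1 + k)).

Definition jac v : 'M[R[i]]_n := \matrix_(j, i) (entry N (v 0) i j)%:C%C.

(** [roots] lists the eigenvalue functions with algebraic multiplicity, [mus] lists each of them
    once. *)
Record spectrum mus roots : Prop := Spectrum {
  spectrum_mem : mus =i roots;
  spectrum_continuous : forall mu, mu \in mus -> continuous (mu : _ -> R[i]^o);
  spectrum_generically : generically (fun v => uniq [seq mu v | mu <- mus] /\
    char_poly (jac v) = \prod_(mu <- roots) ('X - (mu v)%:P)) }.

Lemma spectrum_network_eigenvalues mus roots :
  spectrum mus roots -> network_eigenvalues N mus.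
Proof.
move=> [memE mu_cont gen]; split=> //; apply: generically_generic gen.
move=> f sf [uniq_vals charE]; split=> // z.
rewrite origin_jacobianE // eigenvalue_root_char charE.
rewrite -(big_map (fun mu => mu (first_derivatives f)) predT (fun z => 'X - z%:P)).
by rewrite root_prod_XsubC; apply/esym/eq_mem_map.
Qed.

Lemma uniq_map_inj (T U : eqType) (h : T -> U) (s : seq T) :
  uniq (map h s) -> {in s &, injective h}.
Proof.
elim: s => [//|x s IHs] /= /andP[hx /IHs{}IHs] y z.
rewrite !inE => /predU1P[->|ys] /predU1P[->|zs] // hyz.
- by case/negP: hx; rewrite hyz map_f.
- by case/negP: hx; rewrite -hyz map_f.
- exact: IHs.
Qed.

(** The functions in [mus] take distinct values at v, so the multiplicity of the root [mu v] counts
    the occurrences of [mu] itself. *)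
Lemma alg_mult_jac mus roots v mu : mus =i roots -> mu \in mus ->
  uniq [seq mu v | mu <- mus] ->
  char_poly (jac v) = \prod_(mu <- roots) ('X - (mu v)%:P) ->
  alg_mult (jac v) (mu v) = count_mem mu roots.
Proof.
move=> memE mu_mus uniq_vals charE; rewrite /alg_mult charE.
rewrite -(big_map (fun mu => mu v) predT (fun z => 'X - z%:P)) mu_prod_XsubC.
rewrite count_map; apply: eq_in_count => nu; rewrite -memE => nu_mus /=.
by apply/eqP/eqP => [/(uniq_map_inj uniq_vals)-> | ->].
Qed.

(** Replaces algebraic multiplicities, which depend on f, by occurrence counts in [roots]; only
    geometric multiplicities remain to be studied at each v. *)
Lemma spectrum_annotates mus roots (a : annotation R k) :
  spectrum mus roots -> (forall e, e \in a -> e.1 \in mus) ->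
  (forall mu, mu \in mus -> generically (fun v =>
     if (count_mem mu roots == 2)%N && (geo_mult (jac v) (mu v) == 1)%N
     then count_mem (star mu) a = 1%N /\ count_mem (plain mu) a = 0%N
     else count_mem (star mu) a = 0%N /\
       count_mem (plain mu) a = count_mem mu roots)) ->
  annotates N a.
Proof.
move=> spec a_mus countP; exists mus.
split=> //; first exact: spectrum_network_eigenvalues spec.
move=> mu mu_mus; have [memE _ gen] := spec.
apply: generically_generic (generically_and gen (countP mu mu_mus)).
move=> f sf [[uniq_vals charE]] /=.
rewrite origin_jacobianE // -/(jac (first_derivatives f)).
by rewrite (alg_mult_jac memE).
Qed.

Lemma spectrum_annotates_plain mus roots : spectrum mus roots ->
  (forall mu, count_mem mu roots = 2%N ->
     generically (fun v => geo_mult (jac v) (mu v) != 1%N)) ->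
  annotates N [seq plain mu | mu <- roots].
Proof.
move=> spec semisimple; have memE := spectrum_mem spec.
apply: (spectrum_annotates spec) => [e /mapP[mu mu_roots ->]|mu _].
  by rewrite memE.
have star0 : count_mem (star mu) [seq plain mu | mu <- roots] = 0%N.
  by apply/count_memPn/mapP => -[nu _ []].
have plainE : count_mem (plain mu) [seq plain mu | mu <- roots] = count_mem mu roots.
  by rewrite count_map; apply: eq_count => nu /=; apply/eqP/eqP => [[]|->].
have [mu2|_] := eqVneq (count_mem mu roots) 2%N; last exact: generically_all.
apply: generically_sub (semisimple mu mu2) => v /negbTE -> /=.
by rewrite star0 plainE.
Qed.

Lemma spectrum_annotates_simple mus : spectrum mus mus -> uniq mus ->
  annotates N [seq plain mu | mu <- mus].
Proof.
move=> spec mus_uniq; apply: (spectrum_annotates_plain spec) => mu.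
by rewrite count_uniq_mem //; case: (_ \in _).
Qed.

Lemma geo_mult_gt0 v z : root (char_poly (jac v)) z -> (0 < geo_mult (jac v) z)%N.
Proof. by rewrite -eigenvalue_root_char /geo_mult lt0n mxrank_eq0. Qed.

(** The eigenspace is the kernel of a matrix of rank at most 1. For n = 3 this is how a double
    eigenvalue is shown to be semisimple. *)
Lemma geo_mult_jac v z (u : 'cV_n) (w : 'rV_n) :
  jac v = z%:M + u *m w -> (n.-1 <= geo_mult (jac v) z)%N.
Proof.
move=> jE; rewrite /geo_mult /eigenspace jE [z%:M + _]addrC addrK mxrank_ker.
rewrite -subn1; apply: leq_sub2l.
by rewrite (leq_trans (mxrankM_maxl _ _)) ?rank_leq_col.
Qed.

End Annotations.

Lemma spectrum_annotates_star (R : realType) n k (N : network n k)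
    (s mu : eigfun R k) : spectrum N [:: s; mu] [:: s; mu; mu] -> s != mu ->
  generically (fun v => geo_mult (jac N v) (mu v) = 1%N) ->
  annotates N [:: plain s; star mu].
Proof.
move=> spec smu geo1; have mus : mu != s by rewrite eq_sym.
apply: (spectrum_annotates spec) => [e|nu].
  by rewrite !inE => /orP[] /eqP ->; rewrite /= eqxx ?orbT.
rewrite !inE => /orP[] /eqP -> /=.
  apply: generically_all => v.
  by rewrite eqxx (negbTE mus) !xpair_eqE /= eqxx (negbTE mus).
apply: generically_sub geo1 => v ->.
by rewrite eqxx (negbTE smu) !xpair_eqE /= eqxx (negbTE smu).
Qed.

(** * Synchrony subspaces and quotients *)

Section SynchronySpaces.

Variables (R : realType) (n : nat).

(** The vectors constant on the classes of c, obtained by pulling back along c; below, r chooses a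
    representative of each class. *)
Definition color_space m (c : 'I_n -> 'I_m) : {vspace 'rV[R]_n} :=
  limg (linfun (colsub c : 'rV[R]_m -> 'rV[R]_n)).

Variables (m : nat) (c : 'I_n -> 'I_m) (r : 'I_m -> 'I_n).
Hypothesis rK : cancel r c.

Lemma polydiagonal_color_space :
  polydiagonal [rel i j | c i == c j] (color_space c).
Proof.
move=> x; split=> [/memv_imgP[y _ ->] i j /= /eqP cij|xE].
  by rewrite lfunE !mxE cij.
apply/memv_imgP; exists (\row_y x 0 (r y)); first exact: memvf.
by rewrite lfunE; apply/rowP => i; rewrite !mxE; apply: xE; rewrite /= rK.
Qed.

Lemma dim_color_space : \dim (color_space c) = m.
Proof.
rewrite limg_dim_eq ?dimvf /dim /= ?mul1n //.
apply/eqP; rewrite -subv0; apply/subvP => y.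
rewrite memv_cap memv_ker lfunE => /andP[_ /eqP/rowP y0].
rewrite memv0; apply/eqP/rowP => i; have := y0 (r i).
by rewrite !mxE rK.
Qed.

Definition balanced k (N : network n k) : Prop :=
  forall l i j, c i = c j -> c (src N l i) = c (src N l j).

Lemma mulmx_adjacency k (N : network n k) l (x : 'rV[R]_n) i :
  (x *m (adjacency R N l)^T) 0 i = x 0 (src N l i).
Proof.
rewrite mxE (bigD1 (src N l i)) //= !mxE eqxx mulr1 big1 ?addr0 // => j.
by rewrite !mxE eq_sym => /negbTE ->; rewrite mulr0.
Qed.

Lemma synchrony_color_space k (N : network n k) :
  synchrony N (color_space c) <-> balanced N.
Proof.
split=> [[_ inv] l i j cij|bal].
  (* The vector of colours separates the classes, so invariance applied to it alone shows that
     sources of equally coloured cells are equally coloured. *)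
  pose x : 'rV[R]_n := \row_i (c i)%:R.
  have /polydiagonal_color_space : x *m (adjacency R N l)^T \in color_space c.
    by apply: inv; apply/polydiagonal_color_space => i' j'; rewrite !mxE => /eqP ->.
  move=> /(_ i j); rewrite /= cij eqxx !mulmx_adjacency !mxE => /(_ isT) /eqP.
  by rewrite eqr_nat => /eqP/val_inj.
split; first by exists [rel i j | c i == c j]; apply: polydiagonal_color_space.
move=> l x /polydiagonal_color_space xE; apply/polydiagonal_color_space => i j.
move=> /eqP cij; rewrite !mulmx_adjacency; apply: xE.
by apply/eqP/bal.
Qed.

Definition quotient_network k (N : network n k) : network m k :=
  [tuple [tuple c (src N l (r y)) | y < m] | l < k].

Lemma src_quotient k (N : network n k) l y :
  src (quotient_network N) l y = c (src N l (r y)).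
Proof. by rewrite /src !tnth_mktuple. Qed.

Lemma is_quotient_color_space k (N : network n k) :
  balanced N -> is_quotient N (color_space c) (quotient_network N).
Proof.
move=> bal; exists c; split=> [y||l i]; first by exists (r y).
  exact: polydiagonal_color_space.
by rewrite src_quotient; apply: bal; rewrite rK.
Qed.

End SynchronySpaces.

Lemma is_quotient_fullv (R : realType) n k (N : network n k) :
  is_quotient N (fullv : {vspace 'rV[R]_n}) N.
Proof.
exists id; split=> [y||l i //]; first by exists y.
by move=> x; split=> [_ i j /= /eqP -> //|_]; exact: memvf.
Qed.

(** * Polydiagonals of three cells *)

Section ThreeCells.

Variable R : realType.

(* A two-dimensional polydiagonal of R^3 identifies two cells; it is named by the
   third cell k. *)
Definition isolate (k i : 'I_3) : 'I_2 := if i == k then ord_max else ord0.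

Definition other (k : 'I_3) : 'I_3 := if k == c1 then c2 else c1.

Definition representative (k : 'I_3) (y : 'I_2) : 'I_3 :=
  if y == ord0 then other k else k.

Lemma cell3P (i : 'I_3) : [\/ i = c1, i = c2 | i = c3].
Proof.
case: i => [[|[|[|//]]] ?]; [apply: Or31|apply: Or32|apply: Or33]; exact/val_inj.
Qed.

Lemma representativeK k : cancel (representative k) (isolate k).
Proof.
by move=> y; case: (cell3P k) => ->; case: y => [[|[|//]] ?]; exact/val_inj.
Qed.

Definition full_synchrony : {vspace 'rV[R]_3} :=
  color_space R (fun _ : 'I_3 => ord0 : 'I_1).

Definition isolating (k : 'I_3) : {vspace 'rV[R]_3} := color_space R (isolate k).

Lemma polydiagonal_full_synchrony : polydiagonal (fun _ _ => true) full_synchrony.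
Proof.
have ord0K : cancel (fun _ : 'I_1 => c1) (fun _ : 'I_3 => ord0 : 'I_1).
  by move=> y; rewrite (ord1 y).
exact: (@polydiagonal_color_space R _ _ _ _ ord0K).
Qed.

Lemma polydiagonal_isolating k :
  polydiagonal [rel i j | isolate k i == isolate k j] (isolating k).
Proof. exact: (@polydiagonal_color_space R _ _ _ _ (@representativeK k)). Qed.

(** The indicator of k lies in [isolating k]. If k' differs from k, it separates k from the third
    cell, although [isolating k'] identifies these two. *)
Lemma isolating_inj : injective isolating.
Proof.
move=> k k' kk'; pose x : 'rV[R]_3 := \row_i (i == k)%:R.
have /polydiagonal_isolating x_const : x \in isolating k'.
  rewrite -kk'; apply/polydiagonal_isolating => i j; rewrite /isolate /= !mxE.
  by case: (i == k); case: (j == k).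
have {x_const} x_const i j : isolate k' i == isolate k' j -> (i == k) = (j == k).
  move=> /x_const; rewrite !mxE => /eqP; rewrite eqr_nat.
  by case: (i == k); case: (j == k).
have := (x_const c1 c2, x_const c1 c3, x_const c2 c3).
by case: (cell3P k) => ->; case: (cell3P k') => -> // [[h12 h13] h23];
  (have := h12 isT) || (have := h13 isT) || (have := h23 isT).
Qed.

(** E is an arbitrary relation, but only its symmetric closure on the three pairs of cells matters.
    Of the eight cases, no equality gives the whole space, one isolates a cell, and two already
    imply the third. *)
Lemma polydiagonal3P (E : rel 'I_3) (V : {vspace 'rV[R]_3}) : polydiagonal E V ->
  [\/ V = full_synchrony, exists k, V = isolating k | V = fullv].
Proof.
pose e i j := E i j || E j i => VE.
have {}VE x : (x \in V) = [&& e c1 c2 ==> (x 0 c1 == x 0 c2),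
    e c1 c3 ==> (x 0 c1 == x 0 c3) & e c2 c3 ==> (x 0 c2 == x 0 c3)].
  apply/idP/and3P => [/VE xE|[/implyP x12 /implyP x13 /implyP x23]].
    by split; apply/implyP => /orP[] /xE ->.
  apply/VE => i j; rewrite /e in x12 x13 x23.
  case: (cell3P i) => ->; case: (cell3P j) => -> Eij //.
  - by apply/eqP/x12; rewrite Eij.
  - by apply/eqP/x13; rewrite Eij.
  - by apply/esym/eqP/x12; rewrite Eij orbT.
  - by apply/eqP/x23; rewrite Eij.
  - by apply/esym/eqP/x13; rewrite Eij orbT.
  - by apply/esym/eqP/x23; rewrite Eij orbT.
have isoP k x : (x \in isolating k) = [&& (k == c3) ==> (x 0 c1 == x 0 c2),
    (k == c2) ==> (x 0 c1 == x 0 c3) & (k == c1) ==> (x 0 c2 == x 0 c3)].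
  apply/idP/and3P => [/polydiagonal_isolating xE|[]].
    by split; apply/implyP => /eqP kE; apply/eqP/xE; rewrite kE.
  case: (cell3P k) => -> /implyP x12 /implyP x13 /implyP x23;
    apply/polydiagonal_isolating => i j /=;
    case: (cell3P i) => ->; case: (cell3P j) => -> //= _;
    by rewrite ?(eqP (x12 isT)) ?(eqP (x13 isT)) ?(eqP (x23 isT)).
have fullP x : (x \in full_synchrony) = (x 0 c1 == x 0 c2) && (x 0 c1 == x 0 c3).
  apply/idP/andP => [/polydiagonal_full_synchrony xE|[/eqP x12 /eqP x13]].
    by split; apply/eqP/xE.
  apply/polydiagonal_full_synchrony => i j _.
  by case: (cell3P i) => ->; case: (cell3P j) => ->; rewrite -?x12 -?x13.
case: (e c1 c2) (e c1 c3) (e c2 c3) VE => [] [] [] /= VE;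
  [apply: Or31|apply: Or31|apply: Or31|apply: Or32; exists c3|apply: Or31|
   apply: Or32; exists c2|apply: Or32; exists c1|apply: Or33];
  apply/vspaceP => x; rewrite VE ?memvf // ?isoP ?fullP /= ?andbT //.
- by case: eqP => // ->; rewrite andbb.
- by case: eqP => // ->.
- by rewrite [RHS]andbC; case: eqP => // <-; rewrite eq_sym.
Qed.

End ThreeCells.

(** * Eigenvalues of three-cell networks *)

(** The embedding of R into [R[i]] is isometric, and the function is a + i b. *)
Lemma continuous_Complex (R : realType) (T : topologicalType) (a b : T -> R) :
  continuous a -> continuous b ->
  continuous ((fun x => Complex (a x) (b x)) : T -> R[i]^o).
Proof.
have re_cont : continuous (real_complex R : R -> R[i]^o).
  move=> x; apply/cvgrPdist_lt => e e0.
  have [Ime0 Ree0] : complex.Im e = 0 /\ 0 < complex.Re e.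
    by move: e0; rewrite ltcE /= => /andP[/eqP-> ->].
  near=> y; rewrite -rmorphB normc_def /= expr0n addr0 sqrtr_sqr.
  rewrite ltcE /= Ime0 eqxx /=; near: y.
  exact: (@cvgr_dist_lt _ _ _ (nbhs x) _ id x cvg_id).
move=> a_cont b_cont x.
rewrite (_ : (fun x => _) =
    (fun x => (real_complex R (a x) : R[i]^o) + 'i%C * (real_complex R (b x) : R[i]^o))).
  apply: cvgD; first exact: (cvg_comp _ _ (a_cont x) (re_cont _)).
  apply: (@cvgM _ _ _ _ (cst ('i%C : R[i]^o))); first exact: cvg_cst.
  exact: (cvg_comp _ _ (b_cont x) (re_cont _)).
apply/funext => y; apply/eqP; rewrite eq_complex /=.
by apply/andP; split; apply/eqP; ring.
Unshelve. all: by end_near.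
Qed.

Section RealValuedContinuity.

Variables (R : realType) (T : topologicalType) (f g : T -> R).
Hypotheses (f_cont : continuous f) (g_cont : continuous g).

Lemma addf_continuous : continuous (fun x => f x + g x).
Proof. by move=> x; exact: (continuousD (@f_cont x) (@g_cont x)). Qed.

Lemma subf_continuous : continuous (fun x => f x - g x).
Proof. by move=> x; exact: (continuousB (@f_cont x) (@g_cont x)). Qed.

Lemma mulf_continuous : continuous (fun x => f x * g x).
Proof. by move=> x; exact: (continuousM (@f_cont x) (@g_cont x)). Qed.

Lemma cstf_continuous (a : R) : continuous (fun _ : T => a).
Proof. by move=> x; exact: cvg_cst. Qed.

End RealValuedContinuity.

Section EntryPolynomials.

Variable A : comNzRingType.
Implicit Types m : 'I_3 -> 'I_3 -> A.

Definition row_total m : A := m c1 c1 + m c1 c2 + m c1 c3.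

(* The eigenvalue, besides the row sum, of the quotient isolating c. *)
Definition isolated_value (c : 'I_3) m : A := m c c - m (other c) c.

(* Vanishes if and only if the two eigenvalues of that quotient coincide. *)
Definition gap (c : 'I_3) m : A := row_total m - isolated_value c m.

Definition tdisc m : A := ttr m * ttr m - 4 * tdet m.

(* Vanishes if and only if two eigenvalues of m coincide. *)
Definition separation m : A :=
  (row_total m * row_total m - ttr m * row_total m + tdet m) * tdisc m.

(** Column c is constant off the diagonal, so m maps e_c to [isolated_value c m] times e_c plus a
    multiple of (1,1,1). Modulo (1,1,1) this is an eigenvector; the equation says that its
    eigenvalue is a root of X^2 - [ttr m] X + [tdet m]. *)
Lemma isolated_value_root m s (c : 'I_3) : (forall i, \sum_j m i j = s) ->
  (forall i j, i != c -> j != c -> m i c = m j c) ->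
  isolated_value c m * (ttr m - isolated_value c m) = tdet m.
Proof.
move=> ms; have mc1 i : m i c1 = s - m i c2 - m i c3 by rewrite -(ms i) sum3; ring.
rewrite /isolated_value /ttr /tdet /transverse /other.
case: (cell3P c) => -> /= bal.
(* For c = 1 the equal entries lie in the column that [mc1] eliminates, so their equality is first
   restated on the other two columns. *)
- have -> : m c3 c3 = m c2 c2 + m c2 c3 - m c3 c2.
    have -> : m c3 c3 = s - m c3 c2 - m c3 c1 by rewrite mc1; ring.
    by rewrite (bal c3 c2) // mc1; ring.
  rewrite !mc1; ring.
- have -> : m c3 c2 = m c1 c2 by apply: bal.
  ring.
- have -> : m c2 c3 = m c1 c3 by apply: bal.
  ring.
Qed.

End EntryPolynomials.

Section ThreeCellSpectra.

Variables (R : realType) (k : nat) (N : network 3 k).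
Implicit Types (v : 'rV[R]_(1 + k)) (c : 'I_3).

(* Computable counterpart of [entry N probe]. *)
Definition probe_entry (i j : 'I_3) : int :=
  foldr +%R 0 [seq nth 0 [:: 1; 3; 5; 11; 17; 23] l *+
                   (tnth (nth C_1 N l) i == j) | l <- iota 0 k].

Lemma probe_entryE i j : probe_entry i j = entry N (@probe k) i j.
Proof.
rewrite /entry /probe /= mul0rn add0r /probe_entry foldrE big_map.
rewrite (_ : iota 0 k = index_iota 0 k); last by rewrite /index_iota subn0.
by rewrite big_mkord; apply: eq_bigr => l _; rewrite /src (tnth_nth C_1 N).
Qed.

(** Here the condition is a polynomial in the Jacobian entries, and its test on [probe_entry] is a
    closed computation. *)
Lemma generically_entry_neq0
    (p : forall A : comNzRingType, ('I_3 -> 'I_3 -> A) -> A) :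
  (forall (A B : comNzRingType) (phi : {rmorphism A -> B}) m,
     phi (p A m) = p B (fun i j => phi (m i j))) ->
  p int probe_entry != 0 -> generically (fun v => p R (entry N (v 0)) != 0).
Proof.
move=> p_nat; rewrite (_ : probe_entry = entry N (@probe k)); last first.
  by apply/funext => i; apply/funext => j; rewrite probe_entryE.
have q_nat : natural (fun A (v : 'I_(1 + k) -> A) => p A (entry N v)).
  move=> A B phi v; rewrite p_nat; congr (p B _).
  by apply/funext => i; apply/funext => j; rewrite rmorph_entry.
exact: (generically_neq0 R q_nat).
Qed.

Lemma row_total_entry v : row_total (entry N (v 0)) = \sum_l v 0 l.
Proof. by rewrite -(sum_entry N _ c1) sum3. Qed.

Definition isolated_eigenvalue c : eigfun R k :=
  fun v => (isolated_value c (entry N (v 0)))%:C%C.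

Definition complementary_eigenvalue c : eigfun R k :=
  fun v => (ttr (entry N (v 0)) - isolated_value c (entry N (v 0)))%:C%C.

(* The square root of a real number d is sqrt d + i sqrt (-d), as [Num.sqrt]
   vanishes on negative numbers. *)
Definition quadratic_eigenvalue (e : R) : eigfun R k := fun v =>
  let m := entry N (v 0) in
  Complex ((ttr m + e * Num.sqrt (tdisc m)) / 2) (e * Num.sqrt (- tdisc m) / 2).

Lemma continuous_entry i j : continuous (fun v => entry N (v 0) i j).
Proof.
have coord_cont l (b : bool) : continuous (fun v => v 0 l *+ b).
  by move=> v; exact: (cvgMn (n := b) (@coord_continuous R 1 (1 + k) 0 l v)).
apply: addf_continuous; first exact: coord_cont.
by apply: continuous_big => [|l _]; [exact: add_continuous|exact: coord_cont].
Qed.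

Lemma continuous_ttr : continuous (fun v => ttr (entry N (v 0))).
Proof.
by apply: addf_continuous; apply: subf_continuous; exact: continuous_entry.
Qed.

Lemma continuous_tdisc : continuous (fun v => tdisc (entry N (v 0))).
Proof.
apply: subf_continuous; apply: mulf_continuous; try exact: continuous_ttr.
  exact: cstf_continuous.
apply: subf_continuous; apply: mulf_continuous; apply: subf_continuous;
  exact: continuous_entry.
Qed.

Lemma continuous_isolated_value c :
  continuous (fun v => isolated_value c (entry N (v 0))).
Proof. by apply: subf_continuous; exact: continuous_entry. Qed.

Lemma continuous_valency : continuous (@valency R k : _ -> R[i]^o).
Proof.
apply: continuous_Complex; last exact: cstf_continuous.
by apply: continuous_big => [|l _]; [exact: add_continuous|exact: coord_continuous].
Qed.

Lemma continuous_isolated_eigenvalue c :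
  continuous (isolated_eigenvalue c : _ -> R[i]^o).
Proof.
apply: continuous_Complex; last exact: cstf_continuous.
exact: continuous_isolated_value.
Qed.

Lemma continuous_complementary_eigenvalue c :
  continuous (complementary_eigenvalue c : _ -> R[i]^o).
Proof.
apply: continuous_Complex; last exact: cstf_continuous.
by apply: subf_continuous; [exact: continuous_ttr|exact: continuous_isolated_value].
Qed.

Lemma continuous_quadratic_eigenvalue e :
  continuous (quadratic_eigenvalue e : _ -> R[i]^o).
Proof.
have sqrt_cont (g : 'rV[R]_(1 + k) -> R) :
    continuous g -> continuous (fun v => e * Num.sqrt (g v)).
  move=> g_cont; apply: mulf_continuous; first exact: cstf_continuous.
  by move=> v; exact: (cvg_comp _ _ (g_cont v) (@sqrt_continuous R _)).
apply: continuous_Complex; apply: mulf_continuous; try exact: cstf_continuous.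
  apply: addf_continuous; first exact: continuous_ttr.
  exact/sqrt_cont/continuous_tdisc.
by apply: sqrt_cont => v; exact: (continuousN (@continuous_tdisc v)).
Qed.

End ThreeCellSpectra.

(** * Compatibility of the entry polynomials with ring morphisms *)

Section Naturality.

Variables (A B : comNzRingType) (phi : {rmorphism A -> B}) (m : 'I_3 -> 'I_3 -> A).

Lemma rmorph_ttr : phi (ttr m) = ttr (fun i j => phi (m i j)).
Proof. by rewrite rmorphD !rmorphB. Qed.

Lemma rmorph_tdet : phi (tdet m) = tdet (fun i j => phi (m i j)).
Proof. by rewrite rmorphB !rmorphM !rmorphB. Qed.

Lemma rmorph_row_total : phi (row_total m) = row_total (fun i j => phi (m i j)).
Proof. by rewrite !rmorphD. Qed.

Lemma rmorph_separation : phi (separation m) = separation (fun i j => phi (m i j)).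
Proof.
rewrite /separation /tdisc -rmorph_ttr -rmorph_tdet -rmorph_row_total.
move: (ttr m) (tdet m) (row_total m) => t d s.
by rewrite rmorphM rmorphD !rmorphB !rmorphM rmorph_nat.
Qed.

Lemma rmorph_gap c : phi (gap c m) = gap c (fun i j => phi (m i j)).
Proof. by rewrite rmorphB rmorph_row_total rmorphB. Qed.

End Naturality.

Section Spectra.

Variables (R : realType) (k : nat) (N : network 3 k).
Implicit Types (v : 'rV[R]_(1 + k)) (c : 'I_3) (mu : eigfun R k).

Lemma quadratic_eigenvalue_sum v :
  quadratic_eigenvalue N 1 v + quadratic_eigenvalue N (-1) v =
  (ttr (entry N (v 0)))%:C%C.
Proof.
rewrite /quadratic_eigenvalue; move: (entry N (v 0)) => m.
by apply/eqP; rewrite eq_complex /=; apply/andP; split; apply/eqP; field.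
Qed.

(** For real d one of sqrt d and sqrt (-d) vanishes: their product is 0 and the difference of their
    squares is d. *)
Lemma quadratic_eigenvalue_prod v :
  quadratic_eigenvalue N 1 v * quadratic_eigenvalue N (-1) v =
  (tdet (entry N (v 0)))%:C%C.
Proof.
rewrite /quadratic_eigenvalue; move: (entry N (v 0)) => m.
have sqrt_sub : Num.sqrt (tdisc m) * Num.sqrt (tdisc m) -
    Num.sqrt (- tdisc m) * Num.sqrt (- tdisc m) = tdisc m.
  rewrite -!expr2; have [d0|d0] := leP 0 (tdisc m).
    by rewrite sqr_sqrtr // ler0_sqrtr ?oppr_le0 // expr0n subr0.
  by rewrite (ltr0_sqrtr d0) sqr_sqrtr ?oppr_ge0 ?ltW // expr0n sub0r opprK.
have sqrt_mul : Num.sqrt (tdisc m) * Num.sqrt (- tdisc m) = 0.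
  by have [d0|/ltW d0] := leP 0 (tdisc m); rewrite ?(ler0_sqrtr d0) ?mul0r //
    [X in _ * X]ler0_sqrtr ?mulr0 // oppr_le0.
apply/eqP; rewrite eq_complex /=; apply/andP; split; apply/eqP; last first.
  transitivity (- (Num.sqrt (tdisc m) * Num.sqrt (- tdisc m)) / 2); first by field.
  by rewrite sqrt_mul oppr0 mul0r.
have -> : tdet m = (ttr m * ttr m - tdisc m) / 4 by rewrite /tdisc; field.
move: (Num.sqrt (tdisc m)) (Num.sqrt (- tdisc m)) sqrt_sub {sqrt_mul} => S S' <-.
by field.
Qed.

Lemma row_sum_jac n (Q : network n k) v i :
  \sum_j (entry Q (v 0) i j)%:C%C = valency v.
Proof. by rewrite -rmorph_sum sum_entry. Qed.

Lemma char_poly_jac3 v (mu1 mu2 : R[i]) :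
  mu1 + mu2 = (ttr (entry N (v 0)))%:C%C ->
  mu1 * mu2 = (tdet (entry N (v 0)))%:C%C ->
  char_poly (jac N v) = \prod_(z <- [:: valency v; mu1; mu2]) ('X - z%:P).
Proof.
rewrite (rmorph_ttr (real_complex R)) (rmorph_tdet (real_complex R)) => mu_sum mu_prod.
exact: (char_poly3 (row_sum_jac N v) mu_sum mu_prod).
Qed.

(** With s the valency, [separation] factors as (s - mu1)(s - mu2)(mu1 - mu2)^2: the transverse
    characteristic polynomial at s times its discriminant. *)
Lemma separation_uniq v (mu1 mu2 : R[i]) :
  mu1 + mu2 = (ttr (entry N (v 0)))%:C%C ->
  mu1 * mu2 = (tdet (entry N (v 0)))%:C%C ->
  separation (entry N (v 0)) != 0 -> uniq [:: valency v; mu1; mu2].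
Proof.
move=> mu_sum mu_prod; rewrite -(inj_eq (@complexI R)) rmorph0.
have -> : ((separation (entry N (v 0)))%:C = (valency v - mu1) * (valency v - mu2) *
    ((mu1 - mu2) * (mu1 - mu2)))%C.
  rewrite /separation /tdisc row_total_entry /valency.
  move: (ttr _) (tdet _) (\sum_l _) mu_sum mu_prod => t d s mu_sum mu_prod.
  by rewrite rmorphM rmorphD !rmorphB !rmorphM rmorph_nat /= -mu_sum -mu_prod; ring.
rewrite !mulf_eq0 !subr_eq0 !negb_or /= !inE => /andP[/andP[v1 v2] /andP[m12 _]].
by rewrite (negbTE v1) (negbTE v2) (negbTE m12).
Qed.

(** A point of the real parameter space at which eigenvalue functions are told apart. *)
Definition probe_vector : 'rV[R]_(1 + k) := \row_l (probe l)%:~R.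

Lemma probe_vectorE (p : forall A : comNzRingType, ('I_3 -> 'I_3 -> A) -> A) :
  (forall (A B : comNzRingType) (phi : {rmorphism A -> B}) m,
     phi (p A m) = p B (fun i j => phi (m i j))) ->
  p R (entry N (probe_vector 0)) = (p int (probe_entry N))%:~R.
Proof.
move=> p_nat; rewrite (p_nat _ _ intr); congr (p R _).
apply/funext => i; apply/funext => j; rewrite probe_entryE rmorph_entry.
by congr (entry N _ i j); apply/funext => l; rewrite mxE.
Qed.

(** The same nonzero integer serves twice: the three functions differ because their values at
    [probe_vector] do, and their values are distinct for generic v. *)
Lemma spectrum_separated mu1 mu2 :
  continuous (mu1 : _ -> R[i]^o) -> continuous (mu2 : _ -> R[i]^o) ->
  (forall v, mu1 v + mu2 v = (ttr (entry N (v 0)))%:C%C) ->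
  (forall v, mu1 v * mu2 v = (tdet (entry N (v 0)))%:C%C) ->
  separation (probe_entry N) != 0 ->
  uniq [:: @valency R k; mu1; mu2] /\
  spectrum N [:: @valency R k; mu1; mu2] [:: @valency R k; mu1; mu2].
Proof.
move=> mu1_cont mu2_cont mu_sum mu_prod sep; split.
  apply: (@map_uniq _ _ (fun mu => mu probe_vector)) => /=.
  apply: separation_uniq; rewrite ?mu_sum ?mu_prod //.
  by rewrite (probe_vectorE (@rmorph_separation)) intr_eq0.
split=> [//|mu|].
  rewrite !inE => /or3P[] /eqP ->; [exact: continuous_valency|exact: mu1_cont|].
  exact: mu2_cont.
apply: generically_sub (generically_entry_neq0 R (@rmorph_separation) sep) => v sepv.
split; first exact: separation_uniq.
by rewrite (char_poly_jac3 (mu_sum v) (mu_prod v)) !big_cons !big_nil.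
Qed.

Lemma gapE c v : ((gap c (entry N (v 0)))%:C = valency v - isolated_eigenvalue N c v)%C.
Proof. by rewrite /gap rmorphB row_total_entry. Qed.

Lemma uniq_valency_isolated c : gap c (probe_entry N) != 0 ->
  uniq [:: @valency R k; isolated_eigenvalue N c].
Proof.
move=> gap0; rewrite /= inE andbT; apply: contraNneq gap0 => valE.
rewrite -(intr_eq0 R) -(probe_vectorE (fun A B phi m => @rmorph_gap A B phi m c)).
rewrite -(inj_eq (@complexI R)).
by rewrite gapE -valE subrr.
Qed.

Lemma spectrum_gap n (Q : network n k) c roots :
  gap c (probe_entry N) != 0 ->
  [:: @valency R k; isolated_eigenvalue N c] =i roots ->
  (forall v, char_poly (jac Q v) = \prod_(mu <- roots) ('X - (mu v)%:P)) ->
  spectrum Q [:: @valency R k; isolated_eigenvalue N c] roots.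
Proof.
move=> gap0 memE charE; split=> [//|mu|].
  rewrite !inE => /orP[] /eqP ->; first exact: continuous_valency.
  exact: continuous_isolated_eigenvalue.
apply: generically_sub (generically_entry_neq0 R
  (fun A B phi m => @rmorph_gap A B phi m c) gap0) => v gapv.
split=> //=; rewrite inE andbT -subr_eq0 -gapE.
by rewrite (inj_eq (@complexI R)).
Qed.

Lemma spectrum_quotient c : gap c (probe_entry N) != 0 ->
  spectrum (quotient_network (isolate c) (representative c) N)
    [:: @valency R k; isolated_eigenvalue N c]
    [:: @valency R k; isolated_eigenvalue N c].
Proof.
move=> gap0; apply: spectrum_gap => // v; set Q := quotient_network _ _ _.
(* The class [ord_max] is c alone, so that column of the quotient is column c of N read at the
   representatives [other c] and c. *)
have entryQ y : entry Q (v 0) y ord_max = entry N (v 0) (representative c y) c.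
  have isolateE i : (isolate c i == ord_max) = (i == c).
    by rewrite /isolate; case: (i == c).
  rewrite /entry; congr (_ *+ _ + _).
    by rewrite -isolateE representativeK.
  by apply: eq_bigr => l _; rewrite src_quotient isolateE.
rewrite (char_poly2 (row_sum_jac Q v)) !big_cons !big_nil !entryQ.
by rewrite -rmorphB.
Qed.

Lemma annotates_total : annotates
  (quotient_network (fun _ : 'I_3 => ord0 : 'I_1) (fun _ => c1) N)
  [:: plain (@valency R k)].
Proof.
apply: (@spectrum_annotates_simple _ _ _ _ [:: @valency R k]) => //.
split=> [//|mu|]; first by rewrite inE => /eqP ->; exact: continuous_valency.
apply: generically_all => v; split=> //.
by rewrite (char_poly1 (row_sum_jac _ v)) !big_seq1.
Qed.

End Spectra.

(** * The six lattices *)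

Section Lattices.

Variables (R : realType) (k : nat).
Implicit Types (N : network 3 k) (c : 'I_3).

Definition cells : seq 'I_3 := [:: c1; c2; c3].

Lemma mem_cells c : c \in cells.
Proof. by case: (cell3P c) => ->. Qed.

(** A boolean form of [balanced], running over explicit lists so that it evaluates on concrete
    networks. *)
Definition isolable N c : bool :=
  all (fun X : edge_type 3 => all (fun i => all (fun j =>
    (isolate c i == isolate c j) ==>
    (isolate c (tnth X i) == isolate c (tnth X j))) cells) cells) N.

Lemma isolableP N c : reflect (balanced (isolate c) N) (isolable N c).
Proof.
apply: (iffP allP) => [Nbal l i j cij|bal X /tnthP[l ->]].
  have /allP/(_ i (mem_cells i))/allP/(_ j (mem_cells j)) := Nbal _ (mem_tnth l N).
  by rewrite cij eqxx => /eqP.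
apply/allP => i _; apply/allP => j _; apply/implyP => /eqP cij.
by apply/eqP/bal.
Qed.

Definition isolable_cells N := [seq c <- cells | isolable N c].

Lemma isolable_entry N c (v : 'rV[R]_(1 + k)) i j :
  isolable N c -> i != c -> j != c -> entry N (v 0) i c = entry N (v 0) j c.
Proof.
move=> /isolableP bal ic jc; rewrite /entry (negbTE ic) (negbTE jc).
have isolateE i' : (i' == c) = (isolate c i' == ord_max).
  by rewrite /isolate; case: (i' == c).
congr (_ + _); apply: eq_bigr => l _; rewrite !isolateE (bal l i j) //.
by rewrite /isolate (negbTE ic) (negbTE jc).
Qed.

Lemma isolated_value_entry N c (v : 'rV[R]_(1 + k)) : isolable N c ->
  isolated_value c (entry N (v 0)) *
    (ttr (entry N (v 0)) - isolated_value c (entry N (v 0))) =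
  tdet (entry N (v 0)).
Proof.
move=> cN; apply: (isolated_value_root (s := \sum_l v 0 l)) => [i|i j ic jc].
  exact: sum_entry.
exact: isolable_entry.
Qed.

(** By the classification of polydiagonals, the two-dimensional synchrony subspaces correspond to
    the isolable cells; [mids] follows the order of these cells. *)
Lemma annotated_lattice_intro N (mids : seq (annotation R k)) top :
  size mids = size (isolable_cells N) ->
  (forall j, (j < size mids)%N ->
     let c := nth c1 (isolable_cells N) j in
     annotates (quotient_network (isolate c) (representative c) N)
       (nth [::] mids j)) ->
  annotates N top -> annotated_lattice N mids top.
Proof.
move=> size_mids midsP topP.
have constK : cancel (fun _ : 'I_1 => c1) (fun _ : 'I_3 => ord0 : 'I_1).
  by move=> y; rewrite (ord1 y).
have const_bal : balanced (fun _ : 'I_3 => ord0 : 'I_1) N by [].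
exists (full_synchrony R), [seq isolating R c | c <- isolable_cells N].
split; rewrite ?size_map //; first exact: polydiagonal_full_synchrony.
- split; first by rewrite (map_inj_uniq (@isolating_inj R)) filter_uniq.
  by move=> V /mapP[c _ ->]; exact: dim_color_space (@representativeK c).
- move=> V; split=> [syncV|].
    have [[E /polydiagonal3P[VE|[c VE]|VE]] _] := syncV.
    + exact: Or31.
    + apply: Or32; rewrite VE map_f // mem_filter mem_cells andbT.
      apply/isolableP; rewrite VE in syncV.
      exact/(synchrony_color_space R (@representativeK c)).
    + exact: Or33.
  case=> [->|/mapP[c]|->].
  + exact/(synchrony_color_space R constK).
  + rewrite mem_filter => /andP[/isolableP cN _] ->.
    exact/(synchrony_color_space R (@representativeK c)).
  + split=> [|l x _]; last exact: memvf.
    exists [rel i j | i == j] => x; split=> [_ i j /= /eqP -> //|_].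
    exact: memvf.
- split.
  + exists 1%N, (quotient_network (fun _ : 'I_3 => ord0 : 'I_1) (fun _ => c1) N).
    split; last exact: annotates_total.
    exact: (is_quotient_color_space R constK).
  + move=> j j_mids; have j_cells : (j < size (isolable_cells N))%N by rewrite -size_mids.
    rewrite (nth_map c1) //; set c := nth c1 _ _.
    exists 2%N, (quotient_network (isolate c) (representative c) N).
    split; last exact: midsP.
    apply: (is_quotient_color_space R (@representativeK c)); apply/isolableP.
    by have := mem_nth c1 j_cells; rewrite mem_filter => /andP[].
  + by exists 3%N, N; split; first exact: is_quotient_fullv.
Qed.

Lemma annotates_quotient N c : gap c (probe_entry N) != 0 ->
  annotates (quotient_network (isolate c) (representative c) N)
    [:: plain (@valency R k); plain (isolated_eigenvalue N c)].
Proof.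
move=> gap0; have spec := spectrum_quotient R gap0.
exact: (spectrum_annotates_simple spec (uniq_valency_isolated R gap0)).
Qed.

Lemma lattice4_intro N : isolable_cells N = [::] ->
  separation (probe_entry N) != 0 -> lattice4 R N.
Proof.
move=> cellsE sep; exists (quadratic_eigenvalue N 1), (quadratic_eigenvalue N (-1)).
have [uniq_mus spec] := spectrum_separated (@continuous_quadratic_eigenvalue R k N 1)
  (@continuous_quadratic_eigenvalue R k N (-1)) (@quadratic_eigenvalue_sum R k N)
  (@quadratic_eigenvalue_prod R k N) sep.
split=> //; apply: annotated_lattice_intro; rewrite ?cellsE //.
exact: (spectrum_annotates_simple spec uniq_mus).
Qed.

Lemma lattice5_intro N c : isolable_cells N = [:: c] ->
  separation (probe_entry N) != 0 -> gap c (probe_entry N) != 0 -> lattice5 R N.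
Proof.
move=> cellsE sep gap0; exists (isolated_eigenvalue N c), (complementary_eigenvalue N c).
have cN : isolable N c.
  have : c \in isolable_cells N by rewrite cellsE inE.
  by rewrite mem_filter => /andP[].
have [||uniq_mus spec] := spectrum_separated
  (@continuous_isolated_eigenvalue R k N c)
  (@continuous_complementary_eigenvalue R k N c) _ _ sep.
- by move=> v; rewrite -rmorphD addrC subrK.
- by move=> v; rewrite -rmorphM isolated_value_entry.
split=> //; apply: annotated_lattice_intro; rewrite ?cellsE //=.
  by case=> // _; exact: annotates_quotient.
exact: (spectrum_annotates_simple spec uniq_mus).
Qed.

(** Modulo (1,1,1) the independent vectors e_c and e_c' are both eigenvectors, so their eigenvalues
    add up to the trace of the transverse block. *)
Lemma isolated_value_sum N c c' (v : 'rV[R]_(1 + k)) :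
  c != c' -> isolable N c -> isolable N c' ->
  isolated_value c (entry N (v 0)) + isolated_value c' (entry N (v 0)) =
  ttr (entry N (v 0)).
Proof.
move=> cc' /isolable_entry cN /isolable_entry c'N.
have sumE i : entry N (v 0) i c1 + entry N (v 0) i c2 + entry N (v 0) i c3 = \sum_l v 0 l.
  by rewrite -(sum_entry N _ i) sum3.
move: (cN v) (c'N v) (sumE c1) (sumE c2) (sumE c3) cc'.
rewrite /isolated_value /ttr /transverse /other; move: (entry _ _) => m.
case: (cell3P c) => -> /= bal; case: (cell3P c') => -> //= bal' ? ? ? _.
- have := bal c2 c3 isT isT; have := bal' c1 c3 isT isT; lra.
- have := bal c2 c3 isT isT; have := bal' c1 c2 isT isT; lra.
- have := bal c1 c3 isT isT; have := bal' c2 c3 isT isT; lra.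
- have := bal c1 c2 isT isT; have := bal' c2 c3 isT isT; lra.
- have := bal c1 c2 isT isT; have := bal' c1 c3 isT isT; lra.
Qed.

Lemma lattice6_intro N c c' : isolable_cells N = [:: c; c'] ->
  separation (probe_entry N) != 0 ->
  gap c (probe_entry N) != 0 -> gap c' (probe_entry N) != 0 -> lattice6 R N.
Proof.
move=> cellsE sep gap0 gap0'.
exists (isolated_eigenvalue N c), (isolated_eigenvalue N c').
have cc' : c != c'.
  have : uniq (isolable_cells N) by rewrite filter_uniq.
  by rewrite cellsE /= inE andbT.
have cN d : d \in [:: c; c'] -> isolable N d.
  by rewrite -cellsE mem_filter => /andP[].
have sumE (v : 'rV[R]_(1 + k)) :
    isolated_value c (entry N (v 0)) + isolated_value c' (entry N (v 0)) =
    ttr (entry N (v 0)).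
  by apply: (isolated_value_sum v cc'); apply: cN; rewrite !inE eqxx ?orbT.
have [||uniq_mus spec] := spectrum_separated
  (@continuous_isolated_eigenvalue R k N c)
  (@continuous_isolated_eigenvalue R k N c') _ _ sep.
- by move=> v; rewrite -rmorphD sumE.
- move=> v; rewrite -rmorphM -(@isolated_value_entry N c) ?cN ?inE ?eqxx //.
  by rewrite -sumE addrAC subrr add0r.
split=> //; apply: annotated_lattice_intro; rewrite ?cellsE //=.
  by case=> [|[]] // _; exact: annotates_quotient.
exact: (spectrum_annotates_simple spec uniq_mus).
Qed.

(** The functional w_3 - w_1 is injective on the eigenspace. If it vanishes at w, comparing rows 3
    and 1 gives [transverse m c3 c2] times (w_2 - w_1) = 0, so w is constant, and a nonzero constant
    vector has eigenvalue s. *)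
Lemma rank_eigenspace_le1 (F : fieldType) (m : 'I_3 -> 'I_3 -> F) (s mu : F) :
  (forall i, \sum_j m i j = s) -> s != mu -> transverse m c3 c2 != 0 ->
  (\rank (eigenspace (\matrix_(j, i) m i j) mu) <= 1)%N.
Proof.
move=> ms smu b32; set E := eigenspace _ _.
pose L : 'cV[F]_3 := delta_mx c3 0 - delta_mx c1 0.
rewrite -(mxrank_mul_ker E L) (_ : (E :&: kermx L)%MS = 0).
  by rewrite mxrank0 addn0 rank_leq_col.
apply/eqP/rowV0P => w; rewrite sub_capmx => /andP[/eigenspaceP wE /sub_kermxP wL].
have w3 : w 0 c3 = w 0 c1.
  apply/eqP; rewrite -subr_eq0; move/matrixP/(_ 0 0): wL.
  by rewrite mulmxBr !mxE !sum3 !mxE /= !mulr0 !mulr1 !add0r !addr0 => ->.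
have mwE i : m i c1 * w 0 c1 + m i c2 * w 0 c2 + m i c3 * w 0 c1 = mu * w 0 i.
  have := wE; move=> /rowP/(_ i); rewrite !mxE sum3 !mxE w3 => <-.
  by rewrite ![m i _ * _]mulrC.
have w2 : w 0 c2 = w 0 c1.
  apply/eqP; rewrite -subr_eq0; apply: contraTT b32; rewrite negbK => w21.
  apply/eqP; apply: (mulIf w21); rewrite mul0r /transverse.
  have rowE i : m i c2 * (w 0 c2 - w 0 c1) = mu * w 0 i - s * w 0 c1.
    by rewrite -mwE -(ms i) sum3; ring.
  by rewrite mulrBl !rowE w3 subrr.
have w1 : w 0 c1 = 0.
  have := mwE c1; rewrite w2 -!mulrDl -sum3 ms => /eqP.
  by rewrite -subr_eq0 -mulrBl mulf_eq0 subr_eq0 (negbTE smu) => /eqP.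
by apply/rowP => i; rewrite mxE; case: (cell3P i) => ->; rewrite ?w3 ?w2.
Qed.

Lemma rmorph_transverse i j (A B : comNzRingType) (phi : {rmorphism A -> B})
    (m : 'I_3 -> 'I_3 -> A) :
  phi (transverse m i j) = transverse (fun i j => phi (m i j)) i j.
Proof. exact: rmorphB. Qed.

(** The trace condition makes the isolated value a double root, and a nonzero off-diagonal entry of
    the transverse block keeps that block from being scalar, so the root is defective. *)
Lemma lattice3_intro N c : isolable_cells N = [:: c] ->
  (forall v : 'rV[R]_(1 + k), ttr (entry N (v 0)) =
     isolated_value c (entry N (v 0)) + isolated_value c (entry N (v 0))) ->
  gap c (probe_entry N) != 0 -> transverse (probe_entry N) c3 c2 != 0 ->
  lattice3 R N.
Proof.
move=> cellsE ttrE gap0 b32; pose mu := isolated_eigenvalue (R := R) N c.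
have cN : isolable N c.
  have : c \in isolable_cells N by rewrite cellsE inE.
  by rewrite mem_filter => /andP[].
have charE v : char_poly (jac N v) =
    \prod_(nu <- [:: @valency R k; mu; mu]) ('X - (nu v)%:P).
  rewrite (@char_poly_jac3 R k N v (mu v) (mu v)) ?big_cons ?big_nil //.
    by rewrite ttrE rmorphD.
  by rewrite -(isolated_value_entry v cN) ttrE addrK rmorphM.
have uniq_mus : uniq [:: @valency R k; mu] := uniq_valency_isolated R gap0.
have spec : spectrum N [:: @valency R k; mu] [:: @valency R k; mu; mu].
  by apply: spectrum_gap => // nu; rewrite !inE orbb.
exists mu; split=> //; apply: annotated_lattice_intro; rewrite ?cellsE //=.
  by case=> // _; exact: annotates_quotient.
apply: (spectrum_annotates_star spec); first by move: uniq_mus; rewrite /= inE andbT.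
apply: generically_sub (generically_and
  (generically_entry_neq0 R (fun A B phi m => @rmorph_gap A B phi m c) gap0)
  (generically_entry_neq0 R (@rmorph_transverse c3 c2) b32)) => v [gapv b32v].
apply/eqP; rewrite eqn_leq geo_mult_gt0 ?andbT.
  apply: (rank_eigenspace_le1 (row_sum_jac N v)).
    by rewrite -subr_eq0 -gapE (inj_eq (@complexI R)).
  by rewrite -(rmorph_transverse _ _ (real_complex R)) (inj_eq (@complexI R)).
by rewrite charE !big_cons big_nil !rootM !root_XsubC eqxx orbT.
Qed.

(** When every cell can be isolated, all columns are constant off the diagonal and the Jacobian is a
    scalar matrix plus one of rank at most 1. *)
Lemma lattice2_intro N : isolable_cells N = cells ->
  all (fun c => gap c (probe_entry N) != 0) cells -> lattice2 R N.
Proof.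
move=> cellsE /allP gapP; have gap0 := gapP c1 (mem_cells c1).
pose mu := isolated_eigenvalue (R := R) N c1.
have cN c : isolable N c.
  have : c \in isolable_cells N by rewrite cellsE mem_cells.
  by rewrite mem_filter => /andP[].
pose base c (v : 'rV[R]_(1 + k)) := entry N (v 0) (other c) c.
(* Row i sums to the total of the off-diagonal column values plus the isolated value of cell i; as
   row sums agree, so do the three isolated values. *)
have entryE (v : 'rV[R]_(1 + k)) i j : entry N (v 0) i j =
    isolated_value c1 (entry N (v 0)) *+ (i == j) + base j v.
  have [->|ij] := eqVneq i j; last first.
    rewrite add0r /base; apply: isolable_entry => //.
    by rewrite /other; case: (cell3P j) => ->.
  have sumE i' : entry N (v 0) i' c1 + entry N (v 0) i' c2 + entry N (v 0) i' c3 =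
      \sum_l v 0 l.
    by rewrite -(sum_entry N _ i') sum3.
  have := (isolable_entry v (cN c1) (_ : c2 != c1) (_ : c3 != c1)).
  have := (isolable_entry v (cN c2) (_ : c1 != c2) (_ : c3 != c2)).
  have := (isolable_entry v (cN c3) (_ : c1 != c3) (_ : c2 != c3)).
  move=> /(_ isT isT) ? /(_ isT isT) ? /(_ isT isT) ?.
  move: (sumE c1) (sumE c2) (sumE c3); rewrite mulr1n /isolated_value /base /other.
  by case: (cell3P j) => -> /=; lra.
have isolatedE c : isolated_eigenvalue N c = mu.
  apply/funext => v; congr (_%:C)%C.
  rewrite [LHS]/isolated_value [X in X - _]entryE eqxx mulr1n.
  by rewrite -/(base c v) addrK.
have ttrE (v : 'rV[R]_(1 + k)) : ttr (entry N (v 0)) = isolated_value c1 (entry N (v 0)) +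
    isolated_value c1 (entry N (v 0)).
  rewrite [LHS]/ttr /transverse ![entry N (v 0) _ c2]entryE ![entry N (v 0) _ c3]entryE.
  by rewrite /= mulr0n mulr1n; ring.
have charE v : char_poly (jac N v) =
    \prod_(nu <- [:: @valency R k; mu; mu]) ('X - (nu v)%:P).
  rewrite (@char_poly_jac3 R k N v (mu v) (mu v)) ?big_cons ?big_nil //.
    by rewrite ttrE rmorphD.
  by rewrite -(isolated_value_entry v (cN c1)) ttrE addrK rmorphM.
have uniq_mus : uniq [:: @valency R k; mu] := uniq_valency_isolated R gap0.
have spec : spectrum N [:: @valency R k; mu] [:: @valency R k; mu; mu].
  by apply: spectrum_gap => // nu; rewrite !inE orbb.
have quotP c : annotates (quotient_network (isolate c) (representative c) N)
    [:: plain (@valency R k); plain mu].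
  by rewrite -(isolatedE c); apply: annotates_quotient; rewrite gapP ?mem_cells.
exists mu; split=> //; apply: annotated_lattice_intro; rewrite ?cellsE //=.
  by case=> [|[|[]]] // _; exact: quotP.
apply: (spectrum_annotates_plain spec) => nu nu2; apply: generically_all => v.
have -> : nu = mu.
  by move: nu2; rewrite /=; case: eqP => _; case: eqP => [->|].
have jacE : jac N v = (mu v)%:M + (\col_j (base j v)%:C%C) *m const_mx 1.
  apply/matrixP => j i; rewrite !mxE big_ord1 !mxE mulr1 entryE rmorphD rmorphMn.
  by rewrite eq_sym.
by have := geo_mult_jac jacE; case: (geo_mult _ _) => [|[]].
Qed.

(** Cells 1 and 3 depend only on themselves, so the Jacobian differs from the valency times the
    identity in the row of cell 2 alone. The valency is thus a double eigenvalue, and a semisimple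
    one. *)
Lemma lattice1_intro N : isolable_cells N = [:: c2] ->
  (forall v : 'rV[R]_(1 + k), [/\ entry N (v 0) c1 c2 = 0, entry N (v 0) c1 c3 = 0,
     entry N (v 0) c3 c1 = 0 & entry N (v 0) c3 c2 = 0]) ->
  gap c2 (probe_entry N) != 0 -> lattice1 R N.
Proof.
move=> cellsE entry0 gap0; pose mu := isolated_eigenvalue (R := R) N c2.
pose s (v : 'rV[R]_(1 + k)) := \sum_l v 0 l.
have sumE (v : 'rV[R]_(1 + k)) i :
    entry N (v 0) i c1 + entry N (v 0) i c2 + entry N (v 0) i c3 = s v.
  by rewrite /s -(sum_entry N _ i) sum3.
have charE v : char_poly (jac N v) =
    \prod_(nu <- [:: @valency R k; @valency R k; mu]) ('X - (nu v)%:P).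
  rewrite (@char_poly_jac3 R k N v (valency v) (mu v)) ?big_cons ?big_nil //.
    rewrite -rmorphD; congr (_%:C)%C; rewrite -/(s v) -(sumE v c3).
    rewrite /ttr /transverse /isolated_value /other /=.
    by have [-> -> -> ->] := entry0 v; ring.
  rewrite -rmorphM; congr (_%:C)%C; rewrite -/(s v) -(sumE v c3).
  rewrite /tdet /transverse /isolated_value /other /=.
  by have [-> -> -> ->] := entry0 v; ring.
have uniq_mus : uniq [:: @valency R k; mu] := uniq_valency_isolated R gap0.
have spec : spectrum N [:: @valency R k; mu] [:: @valency R k; @valency R k; mu].
  by apply: spectrum_gap => // nu; rewrite !inE orbA orbb.
exists mu; split=> //; apply: annotated_lattice_intro; rewrite ?cellsE //=.
  by case=> // _; exact: annotates_quotient.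
apply: (spectrum_annotates_plain spec) => nu nu2; apply: generically_all => v.
have -> : nu = @valency R k.
  by move: nu2; rewrite /=; case: eqP => [->|_] //; case: eqP.
pose u : 'cV[R[i]]_3 :=
  \col_j (entry N (v 0) c2 j - s v *+ (j == c2))%:C%C.
have jacE : jac N v = (valency v)%:M + u *m delta_mx 0 c2.
  apply/matrixP => j i; rewrite !mxE big_ord1 !mxE /= /valency -/(s v).
  have [e12 e13 e31 e32] := entry0 v.
  have [e11 e33] : entry N (v 0) c1 c1 = s v /\ entry N (v 0) c3 c3 = s v.
    by rewrite -{1}(sumE v c1) -(sumE v c3) e12 e13 e31 e32 !addr0 !add0r.
  case: (cell3P i) => -> /=.
  - by case: (cell3P j) => -> /=; rewrite ?e11 ?e12 ?e13 !mulr0 addr0.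
  - by rewrite mulr1 -rmorphMn -rmorphD addrC subrK.
  - by case: (cell3P j) => -> /=; rewrite ?e31 ?e32 ?e33 !mulr0 addr0.
by have := geo_mult_jac jacE; case: (geo_mult _ _) => [|[]].
Qed.

End Lattices.

(** * Evaluation on the listed networks *)

Theorem theorem5p4 (R : realType) :
  lattice1 R (E_6 \& E_4) /\
  (lattice2 R net_C /\ lattice2 R (C_1 \& C_2)) /\
  (lattice3 R net_D /\
   forall N, N \in [:: C_1 \& D_1; C_1 \& D_4; C_1 \& D_6; D_1 \& D_4] ->
     lattice3 R N) /\
  (lattice4 R net_A /\
   (forall N, N \in list_I ++ list_II -> lattice4 R N) /\
   lattice4 R net_M6) /\
  (forall N, N \in list_III -> lattice5 R N) /\
  (lattice6 R net_F /\ forall N, N \in list_V -> lattice6 R N).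
Proof.
have expand k (N : network 3 k) (v : 'rV[R]_(1 + k)) i j : entry N (v 0) i j =
    v 0 (lshift k ord0) *+ (i == j) +
    \sum_l v 0 (rshift 1 l) *+ (tnth (tnth N l) i == j) by [].
split.
  apply: lattice1_intro; [by vm_compute| |by vm_compute].
  by move=> v; split; rewrite !(expand, big_ord_recl, big_ord0) /= !mulr0n !addr0.
split; first by split; apply: lattice2_intro; vm_compute.
split.
  split=> [|N].
    apply: (@lattice3_intro _ _ _ c3); [by vm_compute| |by vm_compute|by vm_compute].
    move=> v; rewrite /ttr /isolated_value /transverse.
    by rewrite !(expand, big_ord_recl, big_ord0) /=; ring.
  (* The isolable cell is 1 for [C_1 \& D_6] and 3 for the other three networks. *)
  rewrite !inE => /or4P[] /eqP ->;
    [apply: (@lattice3_intro _ _ _ c3)|apply: (@lattice3_intro _ _ _ c3)|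
     apply: (@lattice3_intro _ _ _ c1)|apply: (@lattice3_intro _ _ _ c3)];
    [by vm_compute| |by vm_compute|by vm_compute
    |by vm_compute| |by vm_compute|by vm_compute
    |by vm_compute| |by vm_compute|by vm_compute
    |by vm_compute| |by vm_compute|by vm_compute];
    move=> v; rewrite /ttr /isolated_value /transverse;
    by rewrite !(expand, big_ord_recl, big_ord0) /=; ring.
(* The remaining criteria are packed into one boolean per shape, so that a whole list of networks is
   settled by a single evaluation. *)
have check4 k (N : network 3 k) : (isolable_cells N == [::]) &&
    (separation (probe_entry N) != 0) -> lattice4 R N.
  by move=> /andP[/eqP cellsE sep]; apply: lattice4_intro.
have check5 k (N : network 3 k) : (if isolable_cells N is [:: c] then
    (separation (probe_entry N) != 0) && (gap c (probe_entry N) != 0)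
    else false) -> lattice5 R N.
  case cellsE : (isolable_cells N) => [|c []] // /andP[sep gap0].
  exact: lattice5_intro cellsE sep gap0.
have check6 k (N : network 3 k) : (if isolable_cells N is [:: c; c'] then
    [&& separation (probe_entry N) != 0, gap c (probe_entry N) != 0 &
        gap c' (probe_entry N) != 0] else false) -> lattice6 R N.
  case cellsE : (isolable_cells N) => [|c [|c' []]] // /and3P[sep gap0 gap0'].
  exact: lattice6_intro cellsE sep gap0 gap0'.
split.
  split; first by apply: check4; vm_compute.
  split; last by apply: check4; vm_compute.
  by move=> N N_in; apply: check4; move: N N_in; apply/allP; vm_compute.
split; first by move=> N N_in; apply: check5; move: N N_in; apply/allP; vm_compute.
split; first by apply: check6; vm_compute.
by move=> N N_in; apply: check6; move: N N_in; apply/allP; vm_compute.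
Qed.
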